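(* Let $g:\mathbb R^n\to\mathbb R\cup\{+\infty\}$ be lsc and convex with $g\not\equiv+\infty$. Then $s_g:(x,\mu)\mapsto e_\mu g(x)$ is an epi-smoothing function for $g$ with $$\operatorname*{Lim\,sup}_{\mu\downarrow0,\,x\to\bar x}\nabla_xs_g(x,\mu)=\partial g(\bar x)\qquad\forall\,\bar x\in\operatorname{dom}g.$$
   Context: Lsc means lower semicontinuous; $\operatorname{dom} g=\{x\mid g(x)<+\infty\}$. For $\mu>0$, the Moreau envelope of $g$ is $e_\mu g(x):=\inf_{w\in\mathbb R^n}\{g(w)+\frac1{2\mu}\|w-x\|^2\}$ (Euclidean norm). $\partial g(\bar x)=\{v\mid g(x)\ge g(\bar x)+v^T(x-\bar x)\ \forall x\in\mathbb R^n\}$. The notation $\mu_k\downarrow0$ means $\mu_k>0$, $\mu_k\to0$. Epi-smoothing function: for $f:\mathbb R^n\to\mathbb R\cup\{+\infty\}$ lsc, $s_f:\mathbb R^n\times\mathbb R_+\to\mathbb R$ is an epi-smoothing function for $f$ if (i) for every $\mu_k\downarrow0$, $s_f(\cdot,\mu_k)$ epi-converges to $f$, i.e. for every $\bar x$: $\liminf_k s_f(x^k,\mu_k)\ge f(\bar x)$ for all $x^k\to\bar x$, and there is $x^k\to\bar x$ with $\limsup_k s_f(x^k,\mu_k)\le f(\bar x)$; and (ii) $s_f(\cdot,\mu)$ is (real-valued and) continuously differentiable for all $\mu>0$. Only values for $\mu>0$ matter; values at $\mu=0$ are irrelevant. $\operatorname*{Lim\,sup}_{\mu\downarrow 0,x\to\bar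 x}\nabla_xs_g(x,\mu)$ is the set of all $v$ for which there exist $x^k\to\bar x$ and $\mu_k\downarrow0$ with $\nabla_xs_g(x^k,\mu_k)\to v$. *)

(* Defs.v *)
From HB Require Import structures.
From mathcomp Require Import all_boot all_order all_algebra.
From mathcomp Require Import all_classical all_reals all_analysis.

Set Implicit Arguments.
Unset Strict Implicit.
Unset Printing Implicit Defensive.

Import Order.TTheory GRing.Theory Num.Theory.
Import numFieldNormedType.Exports.

Local Open Scope classical_set_scope.
Local Open Scope ring_scope.

(* R^n is 'rV[R]_n.  The library norm on it is the sup norm, used here only
   through the topology and the notion of differentiability, both of which are
   the same for every norm.  Quantitative uses of the Euclidean structure go
   through [dotr] and [enorm]. *)

Section EuclideanSpace.
Variables (R : realType) (n : nat).
Implicit Types (x y v : 'rV[R]_n) (f : 'rV[R]_n -> R).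

Definition dotr v y : R := \sum_(i < n) v 0 i * y 0 i.

Definition enorm x : R := Num.sqrt (\sum_(i < n) x 0 i ^+ 2).

Definition gradient f x : 'rV[R]_n := \row_(i < n) 'D_(delta_mx 0 i) f x.

Definition continuously_differentiable f : Prop :=
  (forall x, differentiable f x) /\ continuous (gradient f).

End EuclideanSpace.

Section ExtendedRealFunctions.
Variables (R : realType) (n : nat).
Implicit Types (f g : 'rV[R]_n -> \bar R) (x v : 'rV[R]_n) (mu : R).
Local Open Scope ereal_scope.

Definition edom f : set 'rV[R]_n := [set x | f x < +oo].

(* Meant for functions that avoid -oo, for which the right-hand side is never
   of the form +oo - oo. *)
Definition econvex f : Prop :=
  forall x y (t : R), (0 < t < 1)%R ->
    f (t *: x + (1 - t) *: y)%R <= t%:E * f x + (1 - t)%:E * f y.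

Definition subdifferential g x : set 'rV[R]_n :=
  [set v | forall y, g x + (dotr v (y - x))%:E <= g y].

Definition moreau_envelope mu g x : \bar R :=
  ereal_inf [set g w + ((2 * mu)^-1 * enorm (w - x) ^+ 2)%:E | w in setT].

Definition decreases_to0 (mu : nat -> R) : Prop :=
  (forall k, (0 < mu k)%R) /\ mu @ \oo --> (0 : R)%R.

Definition epi_converges (F : nat -> 'rV[R]_n -> \bar R) f : Prop :=
  forall x,
    (forall u : nat -> 'rV[R]_n, u @ \oo --> x ->
       f x <= limn_einf (fun k => F k (u k))) /\
    (exists u : nat -> 'rV[R]_n,
       u @ \oo --> x /\ limn_esup (fun k => F k (u k)) <= f x).

(* A smoothing s is a function of x and mu, constrained only for mu > 0.  It
   takes values in \bar R so that being real-valued is part of the property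
   instead of being forced by the type. *)
Definition epi_smoothing f (s : 'rV[R]_n -> R -> \bar R) : Prop :=
  [/\ forall mu : nat -> R, decreases_to0 mu ->
        epi_converges (fun k x => s x (mu k)) f,
      forall mu x, (0 < mu)%R -> s x mu \is a fin_num &
      forall mu, (0 < mu)%R ->
        continuously_differentiable (fun x => fine (s x mu))].

Definition gradient_x (s : 'rV[R]_n -> R -> \bar R) x mu : 'rV[R]_n :=
  gradient (fun y => fine (s y mu)) x.

(* Outer limit of H(x, mu) as mu decreases to 0 and x tends to xbar. *)
Definition Limsup (H : 'rV[R]_n -> R -> 'rV[R]_n) (xbar : 'rV[R]_n) :
    set 'rV[R]_n :=
  [set v | exists (u : nat -> 'rV[R]_n) (mu : nat -> R),
     [/\ u @ \oo --> xbar, decreases_to0 mu &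
         (fun k => H (u k) (mu k)) @ \oo --> v]].

End ExtendedRealFunctions.

(* Main.v *)
From HB Require Import structures.
Require Import Defs.
From mathcomp Require Import all_boot all_order all_algebra.
From mathcomp Require Import all_classical all_reals all_analysis.
From mathcomp Require Import ring lra.
Import Order.TTheory GRing.Theory Num.Theory.
Import numFieldNormedType.Exports.
Local Open Scope classical_set_scope.
Local Open Scope ring_scope.

Set Implicit Arguments.
Unset Strict Implicit.
Unset Printing Implicit Defensive.

(** Completing the square and comparing with a subgradient give everything from
one parametrisation. If v is a subgradient of g at p and x = p + mu v, then
testing the infimum that defines e_mu g(y) at w = p bounds it from above by
    g(p) + |p - y|^2 / (2 mu),
and replacing g(w) by its affine minorant g(p) + <v, w - p> and minimising in w
bounds it from below by
    g(p) + (mu / 2) |v|^2 + <v, y - x>.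
Both bounds agree at y = x and differ by |y - x|^2 / (2 mu) elsewhere, so the
envelope is differentiable at x with gradient v ([gradient_envelope]).

Every x has the form p + mu v with v a subgradient at p ([resolvent]): p is the
minimiser of g + |. - x|^2 / (2 mu), and convexity turns minimality into the
subgradient inequality. The minimiser exists because g, bounded below on a ball
by lower semicontinuity, is bounded below by a cone w |-> a - c |w - x|
everywhere by convexity ([cone_minorant]), and a parabola beats a cone
([parabola_ge_line]). Monotonicity of the subdifferential makes v a Lipschitz
function of x ([resolvent_lipschitz]), whence continuity of the gradient.

Epi-convergence: constant sequences give the upper bound as e_mu g <= g; for the
lower bound, near the limit point lower semicontinuity of g suffices, and away
from it the parabola over the cone tends to infinity as mu decreases to 0.

Outer limit of the gradients: if u_k = p_k + mu_k v_k tends to x while the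
gradients v_k tend to w, then p_k = u_k - mu_k v_k tends to x too, and w is a
subgradient at x because the graph of the subdifferential is closed
([subdifferential_closed]). Conversely, if v is a subgradient at x then v is
the gradient at x + mu v for every mu > 0, and these points tend to x. *)

(** * The dot product and the sup norm *)

Section DotProduct.
Variables (R : realType) (n : nat).
Implicit Types (x y v w : 'rV[R]_n) (c : R).

Lemma dotrC x y : dotr x y = dotr y x.
Proof. by apply: eq_bigr => i _; rewrite mulrC. Qed.

Lemma dotrDr x y w : dotr x (y + w) = dotr x y + dotr x w.
Proof.
by rewrite /dotr -big_split; apply: eq_bigr => i _; rewrite mxE mulrDr.
Qed.

Lemma dotrZr c x y : dotr x (c *: y) = c * dotr x y.
Proof.
by rewrite /dotr mulr_sumr; apply: eq_bigr => i _; rewrite mxE mulrCA.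
Qed.

Lemma dotrNr x y : dotr x (- y) = - dotr x y.
Proof. by rewrite -scaleN1r dotrZr mulN1r. Qed.

Lemma dotr0 x : dotr x 0 = 0.
Proof. by rewrite -(scale0r x) dotrZr mul0r. Qed.

Lemma dotrDl x y w : dotr (y + w) x = dotr y x + dotr w x.
Proof. by rewrite -!(dotrC x) dotrDr. Qed.

Lemma dotrZl c x y : dotr (c *: y) x = c * dotr y x.
Proof. by rewrite -!(dotrC x) dotrZr. Qed.

Lemma dotrNl x y : dotr (- y) x = - dotr y x.
Proof. by rewrite -!(dotrC x) dotrNr. Qed.

Definition dotrE := (dotrDl, dotrDr, dotrZl, dotrZr, dotrNl, dotrNr).

Lemma dotr_delta v i : dotr v (delta_mx 0 i) = v 0 i.
Proof.
rewrite /dotr (bigD1 i)//= mxE !eqxx mulr1 big1 ?addr0// => j ji.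
by rewrite mxE (negbTE ji) andbF mulr0.
Qed.

Lemma dotr_ge0 x : 0 <= dotr x x.
Proof. by apply: sumr_ge0 => i _; rewrite -expr2 sqr_ge0. Qed.

Lemma enorm_sqr x : enorm x ^+ 2 = dotr x x.
Proof.
rewrite /enorm sqr_sqrtr; last by apply: sumr_ge0 => i _; rewrite sqr_ge0.
by apply: eq_bigr => i _; rewrite expr2.
Qed.

Lemma norm_coord_le x i : `|x 0 i| <= `|x|.
Proof.
rewrite [leRHS]/Num.norm/= mx_normrE.
exact: (le_bigmax _ (fun ij : 'I_1 * 'I_n => `|x ij.1 ij.2|) (0, i)).
Qed.

Lemma sqr_norm_le_dotr x : `|x| ^+ 2 <= dotr x x.
Proof.
rewrite -[leRHS]enorm_sqr ler_sqr ?nnegrE ?sqrtr_ge0//.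
rewrite [leLHS]/Num.norm/= mx_normrE; apply/bigmax_leP; split=> [|[i j] _ /=].
  exact: sqrtr_ge0.
rewrite (ord1 i) -ler_sqr ?nnegrE ?sqrtr_ge0// enorm_sqr real_normK ?num_real//.
rewrite /dotr (bigD1 j)//= -expr2 lerDl.
by apply: sumr_ge0 => k _; rewrite -expr2 sqr_ge0.
Qed.

Lemma dotr_le_sqr_norm x : dotr x x <= n%:R * `|x| ^+ 2.
Proof.
have -> : n%:R * `|x| ^+ 2 = \sum_(i < n) `|x| ^+ 2.
  by rewrite sumr_const card_ord mulr_natl.
apply: ler_sum => i _.
rewrite -expr2 -real_normK ?num_real// ler_sqr ?nnegrE//.
exact: norm_coord_le.
Qed.

Lemma cvg_dotr (T : Type) (F : set_system T) (FF : Filter F)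
    (f h : T -> 'rV[R]_n) a b :
  f @ F --> a -> h @ F --> b -> (fun t => dotr (f t) (h t)) @ F --> dotr a b.
Proof.
move=> fa hb; apply: cvg_big => [|i _]; first exact: add_continuous.
apply: cvgM.
  exact: (cvg_comp _ _ fa (@coord_continuous _ _ _ 0 i a)).
exact: (cvg_comp _ _ hb (@coord_continuous _ _ _ 0 i b)).
Qed.

Lemma dotr_is_linear v : linear (dotr v : 'rV[R]_n -> R^o).
Proof. by move=> c x y; rewrite dotrDr dotrZr. Qed.

HB.instance Definition _ v :=
  GRing.isLinear.Build R 'rV[R]_n R^o *:%R (dotr v) (dotr_is_linear v).

Lemma compact_closed_ball_norm x (r : R) : 0 < r ->
  compact [set w : 'rV[R]_n | `|w - x| <= r].
Proof.
move=> r0; apply: bounded_closed_compact.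
  exists (r + `|x|); split; first exact: num_real.
  move=> M rM w /= wxr; apply: le_trans (ltW rM).
  by rewrite -[w](subrK x) (le_trans (ler_normD _ _))// lerD2r.
suff -> : [set w : 'rV[R]_n | `|w - x| <= r] = closed_ball x r.
  exact: closed_ball_closed.
rewrite closed_ballE// /closed_ball_; apply/seteqP.
by split=> w /=; rewrite distrC.
Qed.

End DotProduct.

(** * Lower semicontinuous functions *)

Section LowerSemicontinuity.
Variables (R : realType).
Local Open Scope ereal_scope.

Lemma lte_fin_between (x y : \bar R) :
  x < y -> exists2 a : R, x < a%:E & a%:E < y.
Proof.
case: x => [r| |]; case: y => [s| |]//.
- by rewrite lte_fin => /midf_lt[? ?]; exists ((r + s) / 2)%R; rewrite lte_fin.
- by move=> _; exists (r + 1)%R; rewrite ?ltry// lte_fin ltrDl.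
- by move=> _; exists (s - 1)%R; rewrite ?ltNyr// lte_fin gtrBl.
- by move=> _; exists 0%R; rewrite ?ltry ?ltNyr.
Qed.

Variable X : topologicalType.
Implicit Types (f : X -> \bar R) (K : set X).

(** Unlike in the definition of lower semicontinuity, the level may be
infinite. *)
Lemma lsc_near f x e : lower_semicontinuous f -> e < f x ->
  \forall y \near x, e < f y.
Proof.
move=> f_lsc /lte_fin_between[a ea afx].
have [V Vx Vf] := f_lsc x a afx.
by apply: filterS Vx => y /Vf; exact: lt_trans.
Qed.

Lemma lscD_continuous f (q : X -> R) : lower_semicontinuous f ->
  continuous q -> lower_semicontinuous (fun x => f x + (q x)%:E).
Proof.
move=> f_lsc q_cont x a; rewrite -lteBlDr// -EFinB => afx.
have [b + bfx] := lte_fin_between afx; rewrite lte_fin => ab.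
exists [set y | b%:E < f y /\ (a - b < q y)%R] => /=.
  apply: filterI; first exact: lsc_near.
  have : (a - b < q x)%R by rewrite ltrBlDr addrC -ltrBlDr.
  exact: cvgr_gt (q_cont x) _.
move=> y /= [bfy abq]; rewrite -lteBlDr// -EFinB; apply: lt_trans bfy.
by rewrite lte_fin ltrBlDr addrC -ltrBlDr.
Qed.

(** Otherwise each point of K has a neighbourhood on which f exceeds some value
that f takes on K; by compactness a single such value is exceeded on all of K,
including at the point where it is taken. *)
Lemma lsc_attains_min f K : lower_semicontinuous f -> compact K -> K !=set0 ->
  exists2 p, K p & forall w, K w -> f p <= f w.
Proof.
move=> f_lsc cK [w0 Kw0]; apply: contrapT => /forall2NP nomin.
have better p : K p -> exists2 w, K w & f w < f p.
  move=> Kp; apply: contrapT => /forall2NP nobetter; have [//|] := nomin p.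
  apply=> w Kw; rewrite leNgt; apply/negP => fwp.
  by have [] := nobetter w.
pose F := filter_from K (fun w : X => [set i | K i /\ f i <= f w]).
have FF : Filter F.
  apply: filter_from_filter; first by exists w0.
  move=> i j Ki Kj; have [ij|/ltW ji] := leP (f i) (f j).
    by exists i => // k [Kk ki]; split; split=> //; exact: le_trans ij.
  by exists j => // k [Kk kj]; split; split=> //; exact: le_trans ji.
have := (compact_near_coveringP K).1 cK X F (fun i x => f i < f x) FF.
case=> [x Kx|w Kw]; last first.
  move=> /(_ w (conj Kw (lexx _))) wmin.
  by have := wmin w Kw; rewrite ltxx.
have [w Kw fwx] := better x Kx.
exists ([set y | f w < f y], [set i | K i /\ f i <= f w]) => /=.
  by split; [exact: lsc_near|exists w].
by move=> [y i] /= [wy [_ iw]]; exact: le_lt_trans wy.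
Qed.

End LowerSemicontinuity.

(** * Quadratic perturbations of convex functions *)

(** For r > 0, dividing by r makes the line decrease and the parabola increase
with r. This is how the quadratic penalty beats the cone below g, both for the
coercivity at fixed mu and for the blow-up as mu tends to 0. *)
Lemma parabola_ge_line (R : realType) (mu a c s r : R) :
  0 <= mu -> 0 <= a -> 0 < s -> s <= r ->
  a + c * s <= mu * s ^+ 2 -> a + c * r <= mu * r ^+ 2.
Proof.
move=> mu0 a0 s0 sr le_s; rewrite -(ler_pM2l s0).
have r0 : 0 <= r by exact: le_trans (ltW s0) sr.
apply: (@le_trans _ _ ((a + c * s) * r)); first by nra.
apply: (@le_trans _ _ (mu * s ^+ 2 * r)); first exact: ler_wpM2r.
have : 0 <= mu * s * r * (r - s) by rewrite !mulr_ge0 ?subr_ge0// ltW.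
by rewrite expr2; lra.
Qed.

Section ConvexFunctions.
Variables (R : realType) (n : nat) (g : 'rV[R]_n -> \bar R).
Hypotheses (g_notNy : forall x, g x != -oo%E) (g_lsc : lower_semicontinuous g).
Hypotheses (g_convex : econvex g) (g_proper : exists x, g x != +oo%E).
Implicit Types (x y p v w : 'rV[R]_n) (mu a b t : R).

Lemma proper_fin : exists x a, g x = a%:E.
Proof.
have [x] := g_proper; move: (g_notNy x); case gx: (g x) => [a| |]// _ _.
by exists x, a.
Qed.

Lemma econvex_fin x y a b t : g x = a%:E -> g y = b%:E -> 0 < t < 1 ->
  (g (t *: x + (1 - t) *: y) <= (t * a + (1 - t) * b)%:E)%E.
Proof. by move=> gx gy /(g_convex x y); rewrite gx gy -!EFinM -EFinD. Qed.

(** Compactness bounds g below on the unit ball around a point x0 of its domain.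
A value at w outside the ball then cannot be too low, since by convexity the
point where the segment from x0 to w leaves the ball would be too
low as well. *)
Lemma cone_minorant x :
  exists a c, 0 <= c /\ forall w, ((a - c * `|w - x|)%:E <= g w)%E.
Proof.
have [x0 [b gx0]] := proper_fin.
suff [a [c [c0 minor]]] : exists a c,
    0 <= c /\ forall w, ((a - c * `|w - x0|)%:E <= g w)%E.
  exists (a - c * `|x - x0|), c; split=> // w; apply: le_trans (minor w).
  rewrite lee_fin -addrA lerD2l -opprD lerN2 -mulrDr ler_wpM2l//.
  by rewrite [leRHS]addrC; apply: le_trans (ler_normD _ _); rewrite addrA subrK.
have [|p p_ball p_min] := lsc_attains_min g_lsc
    (compact_closed_ball_norm (x := x0) ltr01).
  by exists x0; rewrite /= subrr normr0.
have : (g p <= g x0)%E by apply: p_min; rewrite /= subrr normr0.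
move: p_min (g_notNy p); rewrite gx0; case: (g p) => [m| |]// p_min _.
rewrite lee_fin => mb.
exists m, (b - m); split; first by rewrite subr_ge0.
move=> w; have [w1|w1] := leP `|w - x0| 1.
  apply: le_trans (p_min w w1); rewrite lee_fin gerBl mulr_ge0// subr_ge0//.
move: (g_notNy w); case gw: (g w) => [d| |]// _; last by rewrite leey.
have r0 : 0 < `|w - x0| by exact: lt_trans w1.
have t01 : 0 < `|w - x0|^-1 < 1 by rewrite invr_gt0 r0 invf_lt1.
have := econvex_fin gw gx0 t01.
have -> : `|w - x0|^-1 *: w + (1 - `|w - x0|^-1) *: x0 =
    x0 + `|w - x0|^-1 *: (w - x0).
  by rewrite scalerBl scale1r scalerBr addrCA addrA.
move/(le_trans (p_min _ _)); rewrite /= addrC addKr normrZ.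
rewrite gtr0_norm ?invr_gt0// mulVf ?gt_eqF//= lexx => /(_ isT).
rewrite !lee_fin -(ler_pM2l r0) mulrDr !mulrA mulrBr mulr1 mulfV ?gt_eqF//.
rewrite mul1r; nra.
Qed.

(** Far from x the penalty outweighs the cone below g, so that a minimiser over
a large enough ball is a global one. *)
Lemma quadratic_minimizer mu x : 0 < mu -> exists p a, g p = a%:E /\
  forall w, ((a + mu * dotr (p - x) (p - x))%:E <=
             g w + (mu * dotr (w - x) (w - x))%:E)%E.
Proof.
move=> mu0.
have [a [c [c0 minor]]] := cone_minorant x.
have [x0 [b gx0]] := proper_fin.
pose h w := (g w + (mu * dotr (w - x) (w - x))%:E)%E.
pose H0 := b + mu * dotr (x0 - x) (x0 - x).
(* Large enough for x0 to be in the ball and for mu M to exceed c + |H0 - a|. *)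
pose M := 1 + `|x0 - x| + (c + `|H0 - a|) / mu.
have M0 : 0 <= (c + `|H0 - a|) / mu by rewrite divr_ge0 ?addr_ge0// ltW.
have M_gt0 : 0 < M by rewrite /M; have := normr_ge0 (x0 - x); lra.
have h_lsc : lower_semicontinuous h.
  apply: lscD_continuous => // w.
  have wx : (fun w => w - x) @ w --> w - x.
    exact: (cvgB cvg_id (cvg_cst x)).
  exact: (cvgM (cvg_cst mu) (cvg_dotr _ wx wx)).
have x0_ball : `|x0 - x| <= M by rewrite /M; lra.
have hx0 : h x0 = H0%:E by rewrite /h gx0.
have [|p p_ball p_min] := lsc_attains_min h_lsc
    (compact_closed_ball_norm (x := x) M_gt0).
  by exists x0.
have hp : (h p <= H0%:E)%E by rewrite -hx0; exact: p_min.
have [d gp] : exists d, g p = d%:E.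
  move: hp (g_notNy p); rewrite /h; case: (g p) => [d| |]// _ _.
  by exists d.
exists p, d; split=> // w.
suff: (h p <= h w)%E by rewrite /h gp.
have [wM|Mw] := leP `|w - x| M; first exact: p_min.
apply: le_trans hp _; apply: le_trans (leeD (minor w) (lexx _)).
rewrite -EFinD lee_fin.
have M1 : 1 <= M by rewrite /M; have := normr_ge0 (x0 - x); lra.
have farM : `|H0 - a| + c * M <= mu * M ^+ 2.
  have : c + `|H0 - a| <= mu * M.
    by rewrite mulrC -ler_pdivrMr// /M lerDr addr_ge0.
  have := normr_ge0 (H0 - a); move: `|H0 - a| => e; nra.
have := parabola_ge_line (ltW mu0) (normr_ge0 _) M_gt0 (ltW Mw) farM.
have := sqr_norm_le_dotr (w - x); rewrite -(ler_pM2l mu0).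
have := ler_norm (H0 - a); lra.
Qed.

(** Compare p with the points p + t (y - p): the first-order term in t must be
nonnegative, and 2 mu (x - p) is minus the gradient at p of the penalty. *)
Lemma minimizer_subgradient mu p x a : 0 < mu -> g p = a%:E ->
  (forall w, ((a + mu * dotr (p - x) (p - x))%:E <=
              g w + (mu * dotr (w - x) (w - x))%:E)%E) ->
  subdifferential g p ((2 * mu) *: (x - p)).
Proof.
move=> mu0 gp p_min y; rewrite gp.
move: (g_notNy y); case gy: (g y) => [b| |]// _; last by rewrite leey.
rewrite -EFinD lee_fin.
have slope t : 0 < t < 1 ->
    0 <= b - a - dotr ((2 * mu) *: (x - p)) (y - p) +
         t * (mu * dotr (y - p) (y - p)).
  move=> t01; have t0 : 0 < t by have /andP[] := t01.
  have := p_min (t *: y + (1 - t) *: p).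
  move/le_trans/(_ (leeD (econvex_fin gy gp t01) (lexx _))).
  have -> : t *: y + (1 - t) *: p - x = t *: (y - p) + (p - x).
    by apply/rowP => i; rewrite !mxE; ring.
  rewrite -EFinD lee_fin -(opprB p x); move: (y - p) (p - x) => d e.
  rewrite -(pmulr_rge0 _ t0) !dotrE (dotrC d e); lra.
set A := b - a - _ in slope; set B := mu * _ in slope.
suff: 0 <= A by rewrite /A; lra.
rewrite leNgt; apply/negP => A0.
have B2 : - A * 2 <= B by have := slope (1 / 2); lra.
have B0 : 0 < B by lra.
(* At t = - A / (2 B) the bound A + t B >= 0 reads A / 2 >= 0. *)
have B20 : 0 < 2 * B by lra.
have t01 : 0 < - A / (2 * B) < 1.
  by rewrite ltr_pdivrMr// divr_gt0 ?oppr_gt0//=; lra.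
have := slope _ t01.
have -> : - A / (2 * B) * B = - A / 2 by field; rewrite gt_eqF.
lra.
Qed.

End ConvexFunctions.

(** * The Moreau envelope and its gradient *)

Section MoreauEnvelope.
Variables (R : realType) (n : nat) (g : 'rV[R]_n -> \bar R).
Implicit Types (x y p v w : 'rV[R]_n) (mu a : R).

Let env mu x := fine (moreau_envelope mu g x).

(** The penalised affine minorant of g given by v is minimised at w = y - mu v;
the difference with its minimum is the square of w - y + mu v over 2 mu. *)
Lemma envelope_ge mu p v a y : 0 < mu -> g p = a%:E -> subdifferential g p v ->
  ((a + mu / 2 * dotr v v + dotr v (y - (p + mu *: v)))%:E <=
   moreau_envelope mu g y)%E.
Proof.
move=> mu0 gp gv; apply/ereal_infP => _ [w _ <-].
apply: le_trans (leeD (gv w) (lexx _)).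
rewrite gp -!EFinD lee_fin enorm_sqr.
have c0 : 0 < (2 * mu)^-1 by rewrite invr_gt0 mulr_gt0.
have := dotr_ge0 (w - y + mu *: v); rewrite -(pmulr_rge0 _ c0).
rewrite -subr_ge0 => /le_trans; apply; rewrite le_eqVlt; apply/orP; left.
rewrite !dotrE !(dotrC y) !(dotrC w); apply/eqP; field.
by rewrite gt_eqF.
Qed.

Lemma envelope_le mu p a y : g p = a%:E ->
  (moreau_envelope mu g y <= (a + (2 * mu)^-1 * dotr (p - y) (p - y))%:E)%E.
Proof.
move=> gp; apply: ereal_inf_lbound; exists p => //.
by rewrite gp enorm_sqr EFinD.
Qed.

Lemma envelope_fin_num mu p v a y : 0 < mu -> g p = a%:E ->
  subdifferential g p v -> moreau_envelope mu g y \is a fin_num.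
Proof.
move=> mu0 gp gv; move: (envelope_ge y mu0 gp gv) (envelope_le mu y gp).
by case: (moreau_envelope mu g y).
Qed.

(** At h = 0 the bounds [envelope_ge] and [envelope_le] coincide, which gives
the value of the envelope at p + mu v; elsewhere their gap is the right-hand
side. *)
Lemma envelope_expansion mu p v a h : 0 < mu -> g p = a%:E ->
  subdifferential g p v ->
  `|env mu (h + (p + mu *: v)) - env mu (p + mu *: v) - dotr v h| <=
    (2 * mu)^-1 * dotr h h.
Proof.
move=> mu0 gp gv; rewrite /env; set x := p + mu *: v.
have fin y := envelope_fin_num y mu0 gp gv.
have lb y := envelope_ge y mu0 gp gv.
have ub y := envelope_le mu y gp.
have ubE d : a + (2 * mu)^-1 * dotr (p - (d + x)) (p - (d + x)) =
    a + mu / 2 * dotr v v + dotr v d + (2 * mu)^-1 * dotr d d.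
  have -> : p - (d + x) = - (d + mu *: v).
    by apply/rowP => i; rewrite !mxE; ring.
  by rewrite !dotrE (dotrC d v); field; rewrite gt_eqF.
have ex : moreau_envelope mu g x = (a + mu / 2 * dotr v v)%:E.
  apply/eqP; rewrite eq_le; apply/andP; split.
    apply: le_trans (ub x) _; have := ubE 0; rewrite add0r => ->.
    by rewrite lee_fin !dotr0 !addr0 mulr0 addr0.
  by apply: le_trans (lb x); rewrite lee_fin subrr dotr0 addr0.
have := lb (h + x); have := ub (h + x); have := fin (h + x).
rewrite ubE addrK ex; case: (moreau_envelope mu g (h + x)) => [e| |]//= _.
rewrite !lee_fin => ub_h lb_h; rewrite ger0_norm; lra.
Qed.

(** The remainder in [envelope_expansion] is quadratic in h. *)
Lemma gradient_envelope mu p v a : 0 < mu -> g p = a%:E ->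
  subdifferential g p v ->
  differentiable (env mu) (p + mu *: v) /\ gradient (env mu) (p + mu *: v) = v.
Proof.
move=> mu0 gp gv; set x := p + mu *: v.
have dotv_cont : continuous (dotr v : 'rV[R]_n -> R^o).
  by move=> w; have := cvg_dotr (nbhs_filter w) (cvg_cst v) cvg_id; exact.
pose L : {linear 'rV[R]_n -> R^o} := dotr v.
have expand : (env mu : 'rV[R]_n -> R^o) \o shift x =
    cst (env mu x : R^o) + (L : 'rV[R]_n -> R^o) +o_ (0 : 'rV[R]_n) id.
  apply/eqaddoP => e e0.
  pose C := (2 * mu)^-1 * n%:R.
  have C0 : 0 <= C by rewrite mulr_ge0// invr_ge0 mulr_ge0// ltW.
  have : \forall h \near (0 : 'rV[R]_n), `|h| < e / (C + 1).
    by apply: nbhs0_lt; rewrite divr_gt0// ltr_wpDl.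
  apply: filterS => h; rewrite ltr_pdivlMr ?ltr_wpDl// => hC.
  have -> : (env mu \o shift x - (cst (env mu x) + dotr v)) h =
    env mu (h + x) - env mu x - dotr v h by rewrite -addrA -opprD.
  apply: le_trans (envelope_expansion h mu0 gp gv) _.
  have : (2 * mu)^-1 * dotr h h <= C * `|h| ^+ 2.
    rewrite /C -mulrA ler_wpM2l ?dotr_le_sqr_norm//.
    by rewrite invr_ge0 mulr_ge0// ltW.
  move/le_trans; apply; have := normr_ge0 h; move: `|h| hC => r; nra.
have dE : 'd (env mu) x = dotr v :> (_ -> _).
  exact: (diff_unique (df := L) dotv_cont expand).
have dx : differentiable (env mu) x by apply/diff_locallyP; rewrite dE.
split=> //; apply/rowP => i; rewrite mxE deriveE// dE dotr_delta//.
Qed.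

Lemma subdifferential_monotone p q u v a b : g p = a%:E -> g q = b%:E ->
  subdifferential g p u -> subdifferential g q v ->
  0 <= dotr (u - v) (p - q).
Proof.
move=> gp gq /(_ q) + /(_ p); rewrite gp gq -!EFinD !lee_fin.
rewrite -(opprB p q); move: (p - q) => d; rewrite !dotrE; lra.
Qed.

(** By monotonicity, expanding the square of (p - q) + mu (u - v) leaves at
least mu^2 |u - v|^2. The constant n pays for passing from the Euclidean norm to
the sup norm. *)
Lemma resolvent_lipschitz mu p q u v a b : 0 < mu -> g p = a%:E -> g q = b%:E ->
  subdifferential g p u -> subdifferential g q v ->
  mu * `|u - v| <= n%:R * `|(p + mu *: u) - (q + mu *: v)|.
Proof.
move=> mu0 gp gq gu gv; have mon := subdifferential_monotone gp gq gu gv.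
have -> : p + mu *: u - (q + mu *: v) = (p - q) + mu *: (u - v).
  by apply/rowP => i; rewrite !mxE; ring.
move: (p - q) (u - v) mon => d e mon.
have := dotr_le_sqr_norm (d + mu *: e).
have := sqr_norm_le_dotr e; have := dotr_ge0 d.
rewrite !dotrE (dotrC d e).
move: (dotr d d) (dotr e e) (dotr e d) mon => dd ee ed mon.
move=> dd0 ee_ge le_n.
have mu_ge0 := ltW mu0.
rewrite -ler_sqr ?nnegrE ?mulr_ge0// !exprMn.
have : mu ^+ 2 * `|e| ^+ 2 <= n%:R * `|d + mu *: e| ^+ 2.
  apply: le_trans le_n; nra.
(* The squared constant is n^2, which is at least n. *)
move/le_trans; apply; rewrite ler_wpM2r ?sqr_ge0//.
by rewrite -natrX ler_nat; case: (n) => // k; rewrite leq_pmulr.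
Qed.

End MoreauEnvelope.

(** * Lower and upper limits of sequences *)

Section Sequences.
Variable R : realType.
Local Open Scope ereal_scope.

Lemma limn_einf_ge (u : (\bar R)^nat) l :
  (forall a : R, a%:E < l -> \forall k \near \oo, a%:E <= u k) ->
  l <= limn_einf u.
Proof.
move=> near_ge; rewrite limn_einf_lim (cvg_lim _ (@cvg_einfs_sup _ u))// leNgt.
apply/negP => /lte_fin_between[a sup_a /near_ge[N _ uN]].
have : a%:E <= einfs u N.
  by apply/ereal_infP => _ [j /= Nj <-]; exact: uN.
apply/negP; rewrite -ltNge; apply: le_lt_trans sup_a.
by apply: ereal_sup_ubound; exists N.
Qed.

Lemma limn_esup_le (u : (\bar R)^nat) l : (forall k, u k <= l) ->
  limn_esup u <= l.
Proof.
move=> ul; rewrite limn_esup_lim; apply: lime_le; first exact: is_cvg_esups.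
by apply: nearW => k; apply/ereal_supP => _ [j _ <-].
Qed.

End Sequences.

(** * Epi-convergence of the envelopes *)

Section EpiSmoothing.
Variables (R : realType) (n : nat) (g : 'rV[R]_n -> \bar R).
Hypotheses (g_notNy : forall x, g x != -oo%E) (g_lsc : lower_semicontinuous g).
Hypotheses (g_convex : econvex g) (g_proper : exists x, g x != +oo%E).
Implicit Types (x y p v w : 'rV[R]_n) (mu a b t : R).

(** This is Minty's theorem: the range of the identity plus mu times the
subdifferential is the whole space. *)
Lemma resolvent mu x : 0 < mu -> exists p v a,
  [/\ g p = a%:E, subdifferential g p v & x = p + mu *: v].
Proof.
move=> mu0; have c0 : 0 < (2 * mu)^-1 by rewrite invr_gt0 mulr_gt0.
have [p [a [gp p_min]]] :=
  quadratic_minimizer g_notNy g_lsc g_convex g_proper x c0.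
exists p, ((2 * (2 * mu)^-1) *: (x - p)), a; split=> //.
  exact: minimizer_subgradient p_min.
rewrite scalerA (_ : mu * (2 * (2 * mu)^-1) = 1) ?scale1r ?subrKC//.
by field; rewrite gt_eqF.
Qed.

Lemma gradient_xE mu p v a : 0 < mu -> g p = a%:E -> subdifferential g p v ->
  gradient_x (fun x mu => moreau_envelope mu g x) (p + mu *: v) mu = v.
Proof. by move=> mu0 gp gv; have [_] := gradient_envelope mu0 gp gv. Qed.

Lemma envelope_C1 mu : 0 < mu ->
  continuously_differentiable (fun x => fine (moreau_envelope mu g x)).
Proof.
move=> mu0; split=> x.
  have [p [v [a [gp gv ->]]]] := resolvent x mu0.
  by case: (gradient_envelope mu0 gp gv).
have [p [v [a [gp gv xE]]]] := resolvent x mu0.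
apply/(cvgrPdist_le (FF := nbhs_filter x)) => /= e e0.
(* The Lipschitz constant is n / mu; n + 1 avoids dividing by 0 when n = 0. *)
have r0 : 0 < e * mu / n.+1%:R by rewrite divr_gt0// mulr_gt0.
have := cvgr_dist_le (FF := nbhs_filter x) id x cvg_id _ r0.
apply: filterS => y; rewrite ler_pdivlMr// => xy.
have [q [w [b [gq gw yE]]]] := resolvent y mu0.
move: xy; rewrite xE yE (gradient_envelope mu0 gp gv).2.
rewrite (gradient_envelope mu0 gq gw).2.
move=> xy; rewrite -(ler_pM2r mu0) [leLHS]mulrC; apply: le_trans xy.
apply: le_trans (resolvent_lipschitz mu0 gp gq gv gw) _.
by rewrite mulrC ler_wpM2l// ler_nat.
Qed.

Lemma epi_converges_envelope (mu : nat -> R) : decreases_to0 mu ->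
  epi_converges (fun k x => moreau_envelope (mu k) g x) g.
Proof.
move=> [mu_gt0 mu_cvg0] x; split=> [u ux|]; last first.
  exists (fun=> x); split; first exact: cvg_cst.
  apply: limn_esup_le => k; apply: ereal_inf_lbound; exists x => //.
  by rewrite enorm_sqr subrr dotr0 mulr0 adde0.
apply: limn_einf_ge => a agx.
have [m [c [c0 minor]]] := cone_minorant g_notNy g_lsc g_convex g_proper x.
have /nbhs_ballP[d /= d0 ball_d] := lsc_near g_lsc agx.
(* Half of d separates w from u k, the other half u k from x. *)
pose s := d / 2; have s0 : 0 < s by rewrite divr_gt0.
pose Q := `|a - m| + c * s + c * s.
have Q0 : 0 <= Q by rewrite !addr_ge0 ?mulr_ge0// ltW.
have near_mu : \forall k \near \oo, mu k < s ^+ 2 / (2 * (Q + 1)).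
  apply: (cvgr_lt _ mu_cvg0).
  by rewrite divr_gt0 ?exprn_gt0// mulr_gt0// ltr_wpDl.
have near_u : \forall k \near \oo, `|x - u k| < s.
  exact: cvgr_dist_lt _ _ ux _ s0.
(* Split on whether w is close to x, where g exceeds a, or at distance at least
   s from u k, where the penalty dominates. *)
near=> k; apply/ereal_infP => _ [w _ <-].
have muk0 := mu_gt0 k.
have c2 : 0 < (2 * mu k)^-1 by rewrite invr_gt0 mulr_gt0.
rewrite enorm_sqr.
have [xw|xw] := ltP `|x - w| d.
  rewrite -[leLHS]adde0; apply: leeD.
    by apply: ltW; apply: ball_d; rewrite -ball_normE.
  by rewrite lee_fin mulr_ge0 ?dotr_ge0// ltW.
apply: le_trans (leeD (minor w) (lexx _)); rewrite -EFinD lee_fin.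
have ux_s : `|x - u k| < s by near: k.
have : `|w - x| <= `|w - u k| + `|x - u k|.
  rewrite (distrC x (u k)); apply: le_trans (ler_normD _ _).
  by rewrite addrA subrK.
rewrite (distrC x w) in xw.
have sd : s + s = d by rewrite /s; field.
move=> tri; have sr : s <= `|w - u k| by lra.
have at_s : (`|a - m| + c * s) + c * s <= (2 * mu k)^-1 * s ^+ 2.
  have : mu k < s ^+ 2 / (2 * (Q + 1)) by near: k.
  rewrite ltr_pdivlMr ?mulr_gt0 ?ltr_wpDl// => muQ.
  rewrite [leRHS]mulrC ler_pdivlMr ?mulr_gt0// -/Q; nra.
have := parabola_ge_line (ltW c2) _ s0 sr at_s.
have : 0 <= `|a - m| + c * s by rewrite addr_ge0 ?mulr_ge0// ltW.
move=> -> /(_ isT).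
have := sqr_norm_le_dotr (w - u k); rewrite -(ler_pM2l c2).
have := ler_norm (a - m).
have : c * `|w - x| <= c * (`|w - u k| + s).
  by rewrite ler_wpM2l// (le_trans tri)// lerD2l ltW.
lra.
Unshelve. all: by end_near. Qed.

End EpiSmoothing.

(** * Outer limit of the gradients *)

Section OuterLimit.
Variables (R : realType) (n : nat) (g : 'rV[R]_n -> \bar R).
Hypotheses (g_notNy : forall x, g x != -oo%E) (g_lsc : lower_semicontinuous g).
Implicit Types (x y p v w : 'rV[R]_n) (mu a b t : R).

(** The values g (p k) need not converge, but lower semicontinuity bounds them
from below by any number less than g x, which is what the limit of the
subgradient inequalities requires. *)
Lemma subdifferential_closed (p v : nat -> 'rV[R]_n) x w :
  p @ \oo --> x -> v @ \oo --> w ->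
  (forall k, subdifferential g (p k) (v k)) -> subdifferential g x w.
Proof.
move=> px vw gv y; rewrite leNgt; apply/negP.
move: (g_notNy y); case gy: (g y) => [b| |]// _; last by rewrite ltNge leey.
rewrite -lteBlDr// -EFinB => /lte_fin_between[c].
rewrite lte_fin ltrBlDr -ltrBlDl => bc cgx.
have near_g : \forall k \near \oo, (c%:E < g (p k))%E.
  exact: px (lsc_near g_lsc cgx).
have near_d : \forall k \near \oo, b - c < dotr (v k) (y - p k).
  apply: (cvgr_gt (dotr w (y - x))) bc.
  exact: (cvg_dotr _ vw (cvgB (cvg_cst y) px)).
have [k [cgp bcd]] := filter_ex (filterI near_g near_d).
have := gv k y; rewrite gy; apply/negP; rewrite -ltNge.
apply: lt_le_trans (leeD (ltW cgp) (lexx _)).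
by rewrite -EFinD lte_fin -ltrBlDl.
Qed.

Hypotheses (g_convex : econvex g) (g_proper : exists x, g x != +oo%E).

(** Writing u_k = p_k + mu_k v_k, the p_k tend to x because the v_k converge.
Conversely, if v is a subgradient at x, all the points x + mu v come from the
same p = x, so the gradient there is v whatever mu. *)
Lemma Limsup_gradient_envelope x : edom g x ->
  Limsup (gradient_x (fun x mu => moreau_envelope mu g x)) x =
  subdifferential g x.
Proof.
move=> gx_fin; apply/seteqP; split=> [w [u [mu [ux [mu_gt0 mu0] gradw]]]|v gv].
  have /choice[p /choice[v pv]] : forall k, exists p v,
      [/\ subdifferential g p v, u k = p + mu k *: v &
          gradient_x (fun x mu => moreau_envelope mu g x) (u k) (mu k) = v].
    move=> k.
    have [p [v [a [gp gv uE]]]] :=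
      resolvent g_notNy g_lsc g_convex g_proper (u k) (mu_gt0 k).
    by exists p, v; split=> //; rewrite uE (gradient_xE (mu_gt0 k) gp gv).
  have vw : v @ \oo --> w.
    suff <- : (fun k => gradient_x (fun x mu => moreau_envelope mu g x)
        (u k) (mu k)) = v by [].
    by apply/funext => k; have [] := pv k.
  suff px : p @ \oo --> x.
    by apply: (subdifferential_closed px vw) => k; have [] := pv k.
  have -> : p = (fun k => u k - mu k *: v k).
    by apply/funext => k; have [_ uE _] := pv k; rewrite uE addrK.
  rewrite -[x]subr0 -(scale0r w).
  exact: (cvgB ux (cvgZ mu0 vw)).
have [a gx] : exists a, g x = a%:E.
  move: gx_fin (g_notNy x); rewrite /edom/=.
  by case: (g x) => [a| |]// _ _; exists a.
exists (fun k => x + k.+1%:R^-1 *: v), (fun k => k.+1%:R^-1); split.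
- rewrite -[x in _ --> x]addr0 -(scale0r v).
  apply: cvgD; first exact: cvg_cst.
  apply: cvgZr_tmp; exact: cvg_harmonic.
- by split=> [k|]; [rewrite invr_gt0|exact: cvg_harmonic].
- apply: cvg_near_cst; apply: nearW => k.
  by rewrite (gradient_xE _ gx gv)// invr_gt0.
Qed.

End OuterLimit.

Local Open Scope ereal_scope.

Theorem corollary4p8 (R : realType) (n : nat) (g : 'rV[R]_n -> \bar R)
    (g_notNy : forall x, g x != -oo)
    (g_lsc : lower_semicontinuous g)
    (g_convex : econvex g)
    (g_proper : exists x, g x != +oo) :
  let s_g := fun (x : 'rV[R]_n) (mu : R) => moreau_envelope mu g x in
  epi_smoothing g s_g /\
  forall xbar : 'rV[R]_n, edom g xbar ->
    Limsup (gradient_x s_g) xbar = subdifferential g xbar.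
Proof.
split=> [|xbar]; last exact: Limsup_gradient_envelope.
split=> [mu|mu x mu0|mu]; [exact: epi_converges_envelope| |exact: envelope_C1].
have [p [v [a [gp gv _]]]] := resolvent g_notNy g_lsc g_convex g_proper x mu0.
exact: (envelope_fin_num x mu0 gp gv).
Qed.
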